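(* Let $G=(V,E)$ be a finite simple undirected weighted graph with $|V|=n$. Let $\mathcal{H}=L^2(\Omega)$ with Lebesgue measure, where $\Omega\subset\mathbb{R}^r$ ($r\ge 1$) is compact with non-empty connected interior. Let $\mathcal{V}=V'\otimes\mathcal{H}'$ be a finite dimensional subspace of $S(G,\mathcal{H})\cong\mathbb{C}^n\otimes\mathcal{H}$, where $V'\subset\mathbb{C}^n$ is a subspace and $\mathcal{H}'\subset\mathcal{H}$ is a subspace spanned by analytic functions. Suppose $W\subset V\times\Omega$ determines $\mathcal{V}$. If $W'$ is formed by randomly choosing, according to a distribution absolutely continuous with respect to the Lebesgue measure, $k_v(W)$ points in $\{v\}\times\Omega$ for each $v\in V$, then $W'$ determines $\mathcal{V}$ with probability one.
   Context: A graph signal in a Hilbert space $\mathcal{H}$ is a function $f:V\to\mathcal{H}$; $S(G,\mathcal{H})$ denotes the space of all such signals. It is identified with $\mathbb{C}^n\otimes\mathcal{H}$ via $f\mapsto\sum_{v\in V}v\otimes f(v)$, where $V$ is identified with the standard basis of $\mathbb{C}^n$. For $\mathcal{H}=L^2(\Omega)$, a signal is viewed as a function on $V\times\Omega$, $f(v,x)=f(v)(x)$. The elements of $\mathcal{V}$ are evaluated pointwise using their analytic representatives. A function $g:\Omega\to\mathbb{C}$ is analytic if it can be extended to a connected open neighborhood $U$ of $\Omega$ such that $g$ has a convergent Taylor series expansion in an open neighborhood of $x_0$, for every $x_0\in U$. For a subspace $\mathcal{V}\subset S(G,\mathcal{H})$ of finite dimension $d_{\mathcal{V}}$, a finite subset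 $W\subset V\times\Omega$ of size $d_{\mathcal{V}}$ is said to determine $\mathcal{V}$ if each $f\in\mathcal{V}$ is uniquely determined (among elements of $\mathcal{V}$) by its values at the points of $W$. For $v\in V$, $k_v(W)$ is the number of points of $(\{v\}\times\Omega)\cap W$. The random choice means: the joint distribution of the $\sum_{v}k_v(W)$ chosen points of $\Omega$ is absolutely continuous with respect to Lebesgue measure on the corresponding power of $\Omega$. *)

(* Defs.v *)
From HB Require Import structures.
From mathcomp Require Import all_boot all_order all_algebra finmap.
From mathcomp Require Import complex.
From mathcomp Require Import ring generic_quotient ring_quotient.
From mathcomp Require Import all_classical all_reals all_analysis.
From mathcomp.analysis.showcase Require Import summability.
Set Implicit Arguments.
Unset Strict Implicit.
Unset Printing Implicit Defensive.
Import Order.TTheory GRing.Theory Num.Theory.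
Import numFieldNormedType.Exports.
Local Open Scope classical_set_scope.
Local Open Scope ring_scope.
Local Open Scope quotient_scope.

Record wgraph (R : realType) := WGraph {
  vertex :> finType;
  edge : rel vertex;
  edge_sym : symmetric edge;
  edge_irr : irreflexive edge;
  weight : vertex -> vertex -> R; (* meaningful on edges only *)
  weight_sym : forall u v, weight u v = weight v u }.

(* The image measure under a measurable isomorphism [f]; the proofs about the
   inverse [g] are arguments so that the structure of sigma-finite measure can be
   inferred. *)
Section transport.
Context d1 d2 (T1 : measurableType d1) (T2 : measurableType d2) (R : realType).
Variables (mu : {sigma_finite_measure set T1 -> \bar R}).
Variables (f : T1 -> T2) (g : T2 -> T1).

Definition transport of measurable_fun setT f & measurable_fun setT g &
  cancel f g & cancel g f := pushforward mu f.

Variables (mf : measurable_fun setT f) (mg : measurable_fun setT g).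
Variables (fK : cancel f g) (gK : cancel g f).
Local Notation nu := (transport mf mg fK gK).

Let nu0 : nu set0 = 0%E.
Proof. by rewrite /transport /pushforward preimage_set0 measure0. Qed.

Let nu_ge0 A : (0 <= nu A)%E. Proof. exact: measure_ge0. Qed.

Let nu_sigma_additive : semi_sigma_additive nu.
Proof.
move=> F mF tF mUF; rewrite /transport /pushforward preimage_bigcup.
apply: measure_semi_sigma_additive.
- by move=> n; rewrite -[X in measurable X]setTI; exact: mf.
- apply/trivIsetP => i j _ _ ij; rewrite -preimage_setI.
  by move/trivIsetP : tF => /(_ _ _ _ _ ij) ->//; rewrite preimage_set0.
- by rewrite -preimage_bigcup -[X in measurable X]setTI; exact: mf.
Qed.

HB.instance Definition _ := isMeasure.Build _ _ _ nu
  nu0 nu_ge0 nu_sigma_additive.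

Let nu_sigma_finite : sigma_finite setT nu.
Proof.
have [F FT Ffin] := sigma_finiteT mu; exists (fun i => g @^-1` F i).
  by rewrite -preimage_bigcup -FT preimage_setT.
move=> i; have [mF Fi] := Ffin i; split.
  by rewrite -[X in measurable X]setTI; exact: mg.
rewrite /transport /pushforward -comp_preimage.
by rewrite (_ : _ \o _ = id) ?preimage_id//; exact/funext/fK.
Qed.

HB.instance Definition _ := Measure_isSigmaFinite.Build _ _ _ nu nu_sigma_finite.
End transport.

(* An alias of [mu \x nu] carrying a [sigma_finite_measure] structure: the
   instance the library declares on [\x] itself is shadowed by the one for
   probability measures. *)
Section sprod.
Context d1 d2 (T1 : measurableType d1) (T2 : measurableType d2) (R : realType).
Variables (mu : {sigma_finite_measure set T1 -> \bar R}).
Variables (nu : {sigma_finite_measure set T2 -> \bar R}).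
Local Open Scope ereal_scope.

Definition sprod : set (T1 * T2)%type -> \bar R := mu \x nu.

HB.instance Definition _ := Measure.copy sprod (mu \x nu).

Let sprod_sigma_finite : sigma_finite setT sprod.
Proof.
have /sigma_finiteP[F [TF ndF Foo]] := sigma_finiteT mu.
have /sigma_finiteP[G [TG ndG Goo]] := sigma_finiteT nu.
exists (fun n => F n `*` G n).
  rewrite -setXTT TF TG predeqE => -[x y]; split.
    move=> [/= [n _ Fnx] [k _ Gky]]; exists (maxn n k) => //; split.
    - by move: x Fnx; exact/subsetPset/ndF/leq_maxl.
    - by move: y Gky; exact/subsetPset/ndG/leq_maxr.
  by move=> [n _ []/= ? ?]; split; exists n.
move=> k; have [? ?] := Foo k; have [? ?] := Goo k.
split; first exact: measurableX.
by rewrite /sprod product_measure1E// lte_mul_pinfty// ge0_fin_numE.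
Qed.

HB.instance Definition _ :=
  Measure_isSigmaFinite.Build _ _ _ sprod sprod_sigma_finite.
End sprod.

Section power_measure.
Context d (T : measurableType d) (R : realType).
Variable mu : {sigma_finite_measure set T -> \bar R}.

Definition tcons n (p : T * n.-tuple T) : n.+1.-tuple T := [tuple of p.1 :: p.2].
Definition tuncons n (t : n.+1.-tuple T) : T * n.-tuple T :=
  (thead t, [tuple of behead t]).

Lemma measurable_tcons n : measurable_fun setT (@tcons n).
Proof. exact: measurable_cons. Qed.

Lemma measurable_tuncons n : measurable_fun setT (@tuncons n).
Proof.
apply/measurable_fun_pairP; split; last exact: measurable_behead.
exact: measurable_tnth.
Qed.

Lemma tconsK n : cancel (@tcons n) (@tuncons n).
Proof.
by case=> x t; rewrite /tuncons /tcons theadE; congr pair; exact: val_inj.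
Qed.

Lemma tunconsK n : cancel (@tuncons n) (@tcons n).
Proof. by move=> t; rewrite /tcons /tuncons/= -tuple_eta. Qed.

Fixpoint power_measure n : {sigma_finite_measure set (n.-tuple T) -> \bar R} :=
  match n with
  | 0 => \d_([tuple] : 0.-tuple T)
  | m.+1 => transport (sprod mu (power_measure m)) (@measurable_tcons m)
      (@measurable_tuncons m) (@tconsK m) (@tunconsK m)
  end.
End power_measure.

(* The sigma-algebra generated by the coordinates; for T = R it is the Borel
   sigma-algebra of R^r. *)
Section rV_measurable.
Context d (T : sigmaRingType d) (r : nat).
Let coor (i : 'I_r) (x : 'rV[T]_r) : T := x ord0 i.

Let rv0 : g_sigma_preimage coor set0. Proof. exact: sigma_algebra0. Qed.
Let rvC A : g_sigma_preimage coor A -> g_sigma_preimage coor (~` A).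
Proof. exact: sigma_algebraC. Qed.
Let rvU (F : (set 'rV[T]_r)^nat) : (forall i, g_sigma_preimage coor (F i)) ->
  g_sigma_preimage coor (\bigcup_i F i).
Proof. exact: sigma_algebra_bigcup. Qed.

HB.instance Definition _ := @isMeasurable.Build (measure_tuple_display d)
  'rV[T]_r (g_sigma_preimage coor) rv0 rvC rvU.
End rV_measurable.
Section lebesgue.
Context (R : realType) (r : nat).
Local Notation tupleR := (r.-tuple (measurableTypeR R)).

Definition rV_of_tuple (t : tupleR) : 'rV[R]_r := \row_i tnth t i.
Definition tuple_of_rV (x : 'rV[R]_r) : tupleR := [tuple x ord0 i | i < r].

Lemma rV_of_tupleK : cancel rV_of_tuple tuple_of_rV.
Proof. by move=> t; apply: eq_from_tnth => i; rewrite tnth_mktuple mxE. Qed.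

Lemma tuple_of_rVK : cancel tuple_of_rV rV_of_tuple.
Proof. by move=> x; apply/rowP => i; rewrite mxE tnth_mktuple. Qed.

Lemma measurable_rV_of_tuple : measurable_fun setT rV_of_tuple.
Proof.
move=> _ A mA; pose c i (x : 'rV[R]_r) : measurableTypeR R := x ord0 i.
have cE : (fun (i : 'I_r) (t : tupleR) => tnth t i) =
    (fun i => c i \o rV_of_tuple).
  by apply/funext => i; apply/funext => t /=; rewrite /c mxE.
by rewrite /measurable/= cE g_sigma_preimage_comp; exists A.
Qed.

Lemma measurable_tuple_of_rV : measurable_fun setT tuple_of_rV.
Proof.
move=> _ A mA.
pose c i (x : 'rV[R]_r) : measurableTypeR R := x ord0 i.
have cE : c = (fun i => (fun t : tupleR => tnth t i) \o tuple_of_rV).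
  by apply/funext => i; apply/funext => t /=; rewrite tnth_mktuple.
by rewrite /measurable/= -/c cE g_sigma_preimage_comp; exists A.
Qed.

Definition lebesgueRn : {sigma_finite_measure set 'rV[R]_r -> \bar R} :=
  transport (power_measure lebesgue_measure r) measurable_rV_of_tuple
    measurable_tuple_of_rV rV_of_tupleK tuple_of_rVK.
End lebesgue.

Section L2.
Context (R : realType) (r : nat) (Omega : set 'rV[R]_r).
Local Notation leb := (@lebesgueRn R r).
Local Notation fT := ('rV[R]_r -> R[i]).

(* Real and imaginary parts are square-integrable over Omega; the values off
   Omega are irrelevant. *)
Definition L2fun : {pred fT} := fun f =>
  ((fun x => complex.Re (f x) * \1_Omega x) \in Lfun leb 2%:E) &&
  ((fun x => complex.Im (f x) * \1_Omega x) \in Lfun leb 2%:E).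

Let Lfun2_lin (a b : R) (f g : 'rV[R]_r -> R) : f \in Lfun leb 2%:E ->
  g \in Lfun leb 2%:E -> (fun x => a * f x + b * g x) \in Lfun leb 2%:E.
Proof.
have [_ lin] := Lfun_submod_closed leb (lee1n 2) => fL gL.
have [L0 _] := Lfun_submod_closed leb (lee1n 2).
rewrite (_ : (fun _ => _) = a *: f + (b *: g + 0)).
  exact: lin fL (lin b _ _ gL L0).
by apply/funext => x; rewrite addr0.
Qed.

Lemma L2fun_submod_closed : submod_closed L2fun.
Proof.
split.
  have [L0 _] := Lfun_submod_closed leb (lee1n 2).
  by apply/andP; split; rewrite (_ : (fun _ => _) = 0)//;
    apply/funext => x; rewrite mul0r.
move=> a f g /andP[fR fI] /andP[gR gI]; apply/andP; split.
  have := Lfun2_lin 1 1 (Lfun2_lin (complex.Re a) (- complex.Im a) fR fI) gR.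
  rewrite (_ : (fun x => 1 * _ + _) = fun x => complex.Re ((a *: f + g) x) *
    \1_Omega x)//; apply/funext => x; rewrite !mul1r [(_ + _) x]/(a * f x + g x).
  by case: a (f x) (g x) => [a1 a2] [b1 b2] [c1 c2] /=; ring.
have := Lfun2_lin 1 1 (Lfun2_lin (complex.Re a) (complex.Im a) fI fR) gI.
rewrite (_ : (fun x => 1 * _ + _) = fun x => complex.Im ((a *: f + g) x) *
  \1_Omega x)//; apply/funext => x; rewrite !mul1r [(_ + _) x]/(a * f x + g x).
by case: a (f x) (g x) => [a1 a2] [b1 b2] [c1 c2] /=; ring.
Qed.

HB.instance Definition _ := GRing.isSubmodClosed.Build _ _ L2fun
  L2fun_submod_closed.

Record L2rep := MkL2rep { L2rep_val :> fT; L2repP : L2rep_val \in L2fun }.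

HB.instance Definition _ := [isSub for L2rep_val].
HB.instance Definition _ := [Choice of L2rep by <:].
HB.instance Definition _ := [SubChoice_isSubLmodule of L2rep by <:].

Definition ae_eqOn (f g : fT) : Prop :=
  {ae leb, forall x, Omega x -> f x = g x}.

Definition L2null : {pred L2rep} := fun f => `[< ae_eqOn f 0 >].

Lemma L2nullE (f : L2rep) : f \in L2null = `[< ae_eqOn f 0 >].
Proof. by []. Qed.

Lemma L2null_submod_closed : submod_closed L2null.
Proof.
split; first by rewrite L2nullE; apply/asboolP; apply: aeW.
move=> a f g; rewrite !L2nullE => /asboolP f0 /asboolP g0; apply/asboolP.
apply: filterS2 f0 g0 => x f0 g0 Ox.
rewrite [LHS]/(a * f x + g x) (f0 Ox) (g0 Ox).
have -> : a * (0 : fT) x = 0 by exact: mulr0.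
exact: (@add0r R[i] 0).
Qed.

HB.instance Definition _ := GRing.isSubmodClosed.Build _ _ L2null
  L2null_submod_closed.

Definition L2 : Type := {ideal_quot L2null}.
HB.instance Definition _ := GRing.Zmodule.on L2.
Definition L2class : L2rep -> L2 := \pi_{ideal_quot L2null}.

Let class_eq (f g : L2rep) : L2class f = L2class g <-> f - g \in L2null.
Proof. by rewrite Quotient.idealrBE; split=> /eqP. Qed.

Let reprK (u : L2) : L2class (repr u) = u. Proof. exact: reprK. Qed.

Lemma L2classD : {morph L2class : f g / f + g}.
Proof.
by move=> f g; exact: (raddfD (\pi_{ideal_quot L2null} : {additive L2rep -> _})).
Qed.

Definition L2scale (a : R[i]) (u : L2) : L2 := L2class (a *: repr u).

Lemma L2classZ a f : L2scale a (L2class f) = L2class (a *: f).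
Proof.
apply/class_eq; rewrite -scalerBr rpredZ//; apply/class_eq; exact: reprK.
Qed.

Let scaleA a b u : L2scale a (L2scale b u) = L2scale (a * b) u.
Proof. by rewrite -(reprK u) !L2classZ scalerA. Qed.
Let scale1 : left_id 1 L2scale.
Proof. by move=> u; rewrite -(reprK u) L2classZ scale1r. Qed.
Let scaleDr : right_distributive L2scale +%R.
Proof.
move=> a u v; rewrite -(reprK u) -(reprK v) -L2classD !L2classZ.
by rewrite -L2classD scalerDr.
Qed.
Let scaleDl u : {morph L2scale^~ u : a b / a + b}.
Proof. by move=> a b; rewrite -(reprK u) !L2classZ -L2classD scalerDl. Qed.

HB.instance Definition _ := GRing.Zmodule_isLmodule.Build R[i] L2
  scaleA scale1 scaleDr scaleDl.

End L2.

Section linear_algebra.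
Context (K : fieldType) (M : lmodType K).

Definition lspan (S : set M) : set M := [set u | exists m (c : 'I_m -> K)
  (s : 'I_m -> M), (forall i, S (s i)) /\ u = \sum_i c i *: s i].

Definition has_dim (S : set M) (d : nat) := exists b : 'I_d -> M,
  (forall c : 'I_d -> K, \sum_i c i *: b i = 0 -> forall i, c i = 0) /\
  S = lspan (range b).
End linear_algebra.

Section analytic.
Context (R : realType) (r : nat) (Omega : set 'rV[R]_r).

(* Multi-index series are summed unconditionally, i.e. along the finite sets of
   multi-indices ordered by inclusion. *)
Definition taylor_at (g : 'rV[R]_r -> R[i]) (x0 : 'rV[R]_r) :=
  exists c : {ffun 'I_r -> nat} -> R[i], nbhs x0 [set x : 'rV[R]_r |
    (partial_sum (fun k => c k *
       (\prod_j (x ord0 j - x0 ord0 j) ^+ k j)%:C%C) : _ -> R[i]^o) @ totally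
    --> (g x : R[i]^o)].

Definition analytic_on (g : 'rV[R]_r -> R[i]) :=
  exists (U : set 'rV[R]_r) (h : 'rV[R]_r -> R[i]),
  [/\ open U, connected U, Omega `<=` U, {in Omega, h =1 g} &
      forall x0, U x0 -> taylor_at h x0].

Definition represents (g : 'rV[R]_r -> R[i]) (u : L2 Omega) :=
  exists2 f : L2rep Omega, {in Omega, f =1 g} & L2class f = u.

Definition analytic_rep (u : L2 Omega) (g : 'rV[R]_r -> R[i]) :=
  analytic_on g /\ represents g u.

Definition spanned_by_analytic (H : set (L2 Omega)) :=
  exists2 S : set (L2 Omega),
    forall u, S u -> exists g, analytic_rep u g & H = lspan S.

(* [ev u x] is the value at [x] of the analytic representative of [u].  If Omega
   is connected, this representative is unique on Omega and the linearity
   condition is automatic.  If Omega has pieces away from the closure of its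
   interior, an element of L^2 can have several analytic representatives (the
   domains U may differ), and [ev] is any linear selection among them. *)
Definition analytic_evaluation (H : set (L2 Omega))
    (ev : L2 Omega -> 'rV[R]_r -> R[i]) :=
  (forall u, H u -> analytic_rep u (ev u)) /\
  (forall a u v, H u -> H v ->
    {in Omega, forall x, ev (a *: u + v) x = a * ev u x + ev v x}).
End analytic.

Section signals.
Context (R : realType) (G : wgraph R) (r : nat) (Omega : set 'rV[R]_r).
Local Notation point := (G * 'rV[R]_r)%type.
Local Notation signal := {ffun G -> L2 Omega}.

Definition pure_tensor (phi : {ffun G -> R[i]^o}) (h : L2 Omega) : signal :=
  [ffun v => (phi v : R[i]) *: h].

Definition tensor (V' : {vspace {ffun G -> R[i]^o}}) (H' : set (L2 Omega)) :
    set signal :=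
  lspan [set f | exists phi h, [/\ phi \in V', H' h & f = pure_tensor phi h]].

Definition determines (ev : L2 Omega -> 'rV[R]_r -> R[i]) (V : set signal)
    (d : nat) (W : {fset point}) :=
  [/\ forall p, p \in W -> Omega p.2, #|` W | = d &
      forall f g, V f -> V g ->
        (forall p, p \in W -> ev (f p.1) p.2 = ev (g p.1) p.2) -> f = g].

Definition npoints (v : G) (W : {fset point}) : nat :=
  #|` [fset p in W | p.1 == v]%fset |.

(* The points [x i] of R^r placed at the vertices [vs i]. *)
Definition sample m (vs : m.-tuple G) (x : m.-tuple 'rV[R]_r) : {fset point} :=
  [fset (tnth vs i, tnth x i) | i : 'I_m]%fset.
End signals.

(* Main.v *)
(* List the points of [W] and evaluate a basis of the space at them: [W]
   determines the space iff the determinant [D] of the resulting square matrix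
   is nonzero.  As a function of one point, the others being fixed, [D] is the
   value of the analytic representative of an element of [H'], so on [Omega] it
   vanishes either identically or only on a null set.  By Fubini this
   one-variable alternative passes to [D] on the power of [Omega], and [D] is
   nonzero at the given [W].

   The one-variable alternative rests on the fact that an analytic function on a
   connected open set of R^r vanishes identically or has a null zero set.
   Restricted to a line parallel to an axis, the Taylor expansions become power
   series in one variable, whose zeros are isolated; the same Fubini argument,
   applied to the coordinates of a small box, gives the local form of this fact,
   and connectedness the global one. *)

Require Import Defs.
From mathcomp Require Import all_boot all_order all_algebra finmap.
From mathcomp Require Import complex.
From mathcomp Require Import ring lra.
From mathcomp Require Import all_classical all_reals all_analysis.
From mathcomp Require Import measurable_realfun.
From mathcomp.analysis.showcase Require Import summability.
Set Implicit Arguments.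
Unset Strict Implicit.
Unset Printing Implicit Defensive.
Import Order.TTheory GRing.Theory Num.Theory.
Import numFieldNormedType.Exports.
Local Open Scope classical_set_scope.
Local Open Scope ring_scope.

(** * Fubini for sets whose coordinate sections are full or null *)

Definition tset T n (t : n.-tuple T) (i : 'I_n) (y : T) : n.-tuple T :=
  [tuple if j == i then y else tnth t j | j < n].

Lemma tset_id T n (t : n.-tuple T) (i : 'I_n) : tset t i (tnth t i) = t.
Proof. by apply: eq_from_tnth => j; rewrite tnth_mktuple; case: eqP => // ->. Qed.

Lemma tset_tcons0 d (T : measurableType d) n (x y : T) (t : n.-tuple T) :
  tset (tcons (x, t)) ord0 y = tcons (y, t).
Proof.
apply: eq_from_tnth => j; rewrite tnth_mktuple.
by case: (unliftP ord0 j) => [k|] ->; rewrite ?eqxx//= !tnthS.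
Qed.

Lemma tset_tcons_lift d (T : measurableType d) n (x y : T) (t : n.-tuple T) i :
  tset (tcons (x, t)) (lift ord0 i) y = tcons (x, tset t i y).
Proof.
apply: eq_from_tnth => j; rewrite tnth_mktuple.
case: (unliftP ord0 j) => [k|] ->; last by [].
by rewrite (inj_eq lift_inj)/= !tnthS tnth_mktuple.
Qed.

(** The sides are indexed by all of [nat], so that dropping the first coordinate in an induction is
    a shift of [Q]. *)
Definition tbox T (Q : nat -> set T) n : set (n.-tuple T) :=
  [set t | forall i : 'I_n, Q i (tnth t i)].

Arguments tbox {T} Q n.

Section power_measure.
Context d (T : measurableType d) (R : realType).
Variable mu : {sigma_finite_measure set T -> \bar R}.

Lemma tbox_tcons (Q : nat -> set T) n :
  @tcons _ T n @^-1` tbox Q n.+1 = Q 0%N `*` tbox (fun k => Q k.+1) n.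
Proof.
apply/seteqP; split=> [[x t] xt|[x t] [xt tQ]] /=.
  split; first exact: (xt ord0).
  by move=> i; have := xt (lift ord0 i); rewrite /tcons/= tnthS.
move=> i; case: (unliftP ord0 i) => [k|] ->; last exact: xt.
by rewrite /tcons/= tnthS; exact: tQ.
Qed.

Lemma measurable_tbox (Q : nat -> set T) n :
  (forall k, measurable (Q k)) -> measurable (tbox Q n).
Proof.
elim: n Q => [|n IHn] Q mQ.
  by rewrite (_ : tbox Q 0 = setT)//; apply/seteqP; split=> // t _ [].
rewrite (_ : tbox Q n.+1 =
    @tuncons _ T n @^-1` (Q 0%N `*` tbox (fun k => Q k.+1) n)).
  rewrite -[X in measurable X]setTI; apply: measurable_tuncons => //.
  by apply: measurableX => //; exact: IHn.
by rewrite -tbox_tcons; apply/funext => t; rewrite /preimage/= tunconsK.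
Qed.

Lemma power_measureS n (A : set (n.+1.-tuple T)) :
  power_measure mu n.+1 A = (mu \x power_measure mu n)%E (@tcons _ T n @^-1` A).
Proof. by []. Qed.

Lemma power_measure_tbox_gt0 (Q : nat -> set T) n :
  (forall k, measurable (Q k)) -> (forall k, 0 < mu (Q k))%E ->
  (0 < power_measure mu n (tbox Q n))%E.
Proof.
elim: n Q => [|n IHn] Q mQ Q0.
  have -> : tbox Q 0 = setT by apply/seteqP; split=> // t _ [].
  by rewrite /= diracT lte01.
rewrite power_measureS tbox_tcons product_measure1E//; last exact: measurable_tbox.
by apply: mule_gt0; [exact: Q0|exact: IHn].
Qed.

(* If [p] is in the box but not in [Z], the section of [Z] along the first
   coordinate through [p] is not full, hence null; for any first coordinate [x]
   outside it, the slice of [Z] at [x] misses the tail of [p], hence is null by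
   induction. *)
Lemma power_measure_dichotomy (Q : nat -> set T) n (Z : set (n.-tuple T)) :
  (forall k, measurable (Q k)) -> measurable Z -> Z `<=` tbox Q n ->
  (forall t (i : 'I_n), tbox Q n t ->
    (forall y, Q i y -> Z (tset t i y)) \/
    mu.-negligible [set y | Z (tset t i y)]) ->
  tbox Q n `<=` Z \/ power_measure mu n Z = 0.
Proof.
elim: n Q Z => [|n IHn] Q Z mQ mZ ZQ HZ.
  case: (pselect (Z [tuple])) => [Z0|nZ0]; [left|right].
    by move=> t _; rewrite tuple0.
  by rewrite [LHS]diracE memNset.
case: (pselect (tbox Q n.+1 `<=` Z)) => [|/existsNP]; [by left|].
move=> [p /not_implyP[pQ pZ]]; right.
pose A := @tcons _ T n @^-1` Z; pose Q' k := Q k.+1.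
have mA : measurable A.
  rewrite -[X in measurable X]setTI; exact: measurable_tcons.
have IH x : Q 0%N x ->
    tbox Q' n `<=` xsection A x \/ power_measure mu n (xsection A x) = 0.
  move=> Qx; apply: IHn => //.
  - by move=> k; exact: mQ.
  - exact: measurable_xsection.
  - move=> t; rewrite /xsection/= inE => /ZQ.
    by rewrite -[tbox _ _ _]/((@tcons _ T n @^-1` tbox Q n.+1) (x, t)) tbox_tcons => -[].
  - move=> t i tQ.
    have : tbox Q n.+1 (tcons (x, t)).
      by rewrite -[tbox _ _ _]/((@tcons _ T n @^-1` tbox Q n.+1) (x, t)) tbox_tcons.
    move=> /(HZ _ (lift ord0 i))[Zt|Zt]; [left => y Qy|right].
      by rewrite /xsection/= inE/= /A/= -tset_tcons_lift; exact: Zt.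
    apply: negligibleS Zt => y; rewrite /xsection/= inE/= /A/=.
    by rewrite -tset_tcons_lift.
have pE : p = tcons (tuncons p) by rewrite tunconsK.
have pQ' : (Q 0%N `*` tbox Q' n) (tuncons p).
  by rewrite -tbox_tcons /= -pE.
have N0 : mu.-negligible [set x | Z (tcons (x, (tuncons p).2))].
  have [Zp|] := HZ p ord0 pQ.
    by case: pZ; rewrite -(tset_id p ord0); exact/Zp/(pQ ord0).
  apply: negligibleS => y; rewrite /mkset.
  have tE q : tset (tcons q) ord0 y = tcons (y, q.2).
    by case: q => a b; exact: tset_tcons0.
  by rewrite -tE -pE.
rewrite power_measureS /product_measure1.
rewrite -[RHS](integral0 mu setT).
apply: ae_eq_integral => //; first exact: measurable_fun_xsection.
apply: negligibleS N0 => x /= /not_implyP[_ /eqP xA].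
case: (pselect (Q 0%N x)) => [Qx|nQx].
  have [|/eqP] := IH x Qx; last by rewrite (negbTE xA).
  by move=> /(_ _ pQ'.2); rewrite /xsection/= inE.
(* Over a first coordinate outside [Q 0] the slice is empty, because [Z] lies in the box. *)
exfalso; move/eqP: xA; apply; rewrite (_ : xsection A x = set0) ?measure0//.
apply/seteqP; split=> // t; rewrite /xsection/= inE => /ZQ.
by rewrite -[tbox _ _ _]/((@tcons _ T n @^-1` tbox Q n.+1) (x, t)) tbox_tcons => -[].
Qed.

End power_measure.

(** * Topology and Lebesgue measure *)

(* [N] stands for the negligible sets of a measure; keeping it abstract avoids
   a structure joining topological and measurable types. *)
Section sigma_ideal_topology.
Context (T : ptopologicalType) (N : set T -> Prop).
Hypotheses (N0 : N set0) (NS : forall A B, A `<=` B -> N B -> N A).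
Hypothesis NU : forall A B, N A -> N B -> N (A `|` B).

(** Finitely many of the given neighbourhoods cover [K], and [N] is stable under finite unions and
    subsets. *)
Lemma locally_small_compact (K Z : set T) : compact K ->
  (forall x : T, K x -> exists2 V, nbhs x V & N (V `&` Z)) -> N (K `&` Z).
Proof.
rewrite compact_cover => cK KZ.
pose W := [set V : set T | N (V `&` Z)].
have {}KZ x : exists V, K x -> nbhs x V /\ N (V `&` Z).
  have [/KZ[V ? ?]|nK] := pselect (K x); first by exists V.
  by exists set0 => /nK.
have [V VP] := choice KZ.
have [||D DK KD] := cK T K (fun x => (V x)°).
- by move=> i _; exact: open_interior.
- by move=> x Kx; exists x => //; exact: (VP x Kx).1.
have: N (\big[setU/set0]_(x <- D) (V x `&` Z)).
  rewrite big_seq; elim/big_ind : _ => // x /DK; rewrite inE => Kx.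
  exact: (VP x Kx).2.
apply: NS => x [/KD[y yD Vyx] Zx].
rewrite -bigcup_fset; exists y => //; split => //.
exact: interior_subset Vyx.
Qed.

(** The part of [U] in the interior of [Z] is relatively open. It is also relatively closed: the
    other points of [U] have a neighbourhood meeting [Z] in an [N]-set, such points form an open
    set, and no point is of both kinds since neighbourhoods are not [N]-sets. So this part is empty
    or all of [U]; if it is empty, compactness of [K] applies. *)
Lemma connected_zero_dichotomy (U K Z : set T) :
  connected U -> compact K -> K `<=` U ->
  (forall (x : T) V, nbhs x V -> ~ N V) ->
  (forall x : T, U x -> nbhs x Z \/ exists2 V, nbhs x V & N (V `&` Z)) ->
  U `<=` Z \/ N (K `&` Z).
Proof.
move=> cU cK KU nN UZ.
have [A0|] := pselect (U `&` Z° !=set0); [left|move=> A0; right].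
  have <- : U `&` Z° = U; last by move=> x [_ /interior_subset].
  apply: cU => //; first by exists Z°; [exact: open_interior|].
  pose W := \bigcup_(V in [set V | N (V `&` Z)]) V°.
  exists (~` W).
    by apply: open_closedC; apply: bigcup_open => V _; exact: open_interior.
  apply/seteqP; split=> x [Ux Zx]; split=> //.
    move=> [V NV Vx]; apply: (nN x) NV; exact: filterI.
  by have [//|[V Vx NV]] := UZ x Ux; case: Zx; exists V.
apply: locally_small_compact => // x /KU Ux.
by have [Zx|//] := UZ x Ux; case: A0; exists x.
Qed.

End sigma_ideal_topology.

(** * Balls, neighbourhoods and compact sets under Lebesgue measure *)

Section lebesgueRn_balls.
Context (R : realType) (r : nat).
Implicit Types (x : 'rV[R]_r) (e : R).

(** Balls of row vectors are those of the sup norm, hence boxes in coordinates. The default [0] of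
    [nth] is never met, as only indices below [r] occur. *)
Lemma preimage_rV_ball x e : 0 < e ->
  @rV_of_tuple R r @^-1` ball x e =
  tbox (fun k => ball (nth 0 (tuple_of_rV x) k) e : set (measurableTypeR R)) r.
Proof.
move=> e0; apply/seteqP; split=> [t [_ xt] i|t xt].
  by have := xt ord0 i; rewrite mxE -tnth_nth tnth_mktuple.
split=> // j i; rewrite ord1 mxE.
by have := xt i; rewrite -tnth_nth tnth_mktuple.
Qed.

Lemma measurable_rV_ball x e : 0 < e -> measurable (ball x e).
Proof.
move=> e0; rewrite (_ : ball x e = @tuple_of_rV R r @^-1`
    (@rV_of_tuple R r @^-1` ball x e)).
  rewrite preimage_rV_ball// -[X in measurable X]setTI.
  apply: measurable_tuple_of_rV => //; apply: measurable_tbox => k.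
  exact: measurable_ball.
by rewrite -comp_preimage (_ : _ \o _ = id) ?preimage_id//; exact/funext/tuple_of_rVK.
Qed.

Lemma lebesgueRn_nbhs_not_negligible x (V : set 'rV[R]_r) : nbhs x V ->
  ~ (@lebesgueRn R r).-negligible V.
Proof.
move=> /nbhs_ballP[e /= e0 eV] /(negligibleS eV).
move=> /(negligibleP _ (measurable_rV_ball x e0)).
rewrite /lebesgueRn/= /transport /pushforward preimage_rV_ball//.
apply/eqP; rewrite gt_eqF//; apply: power_measure_tbox_gt0 => k.
  exact: measurable_ball.
by rewrite [X in (_ < X)%E](lebesgue_measure_ball _ (ltW e0)) lte_fin mulrn_wgt0.
Qed.

Lemma lebesgue_nbhs_not_negligible (x : R) (V : set R) : nbhs x V ->
  ~ negligible (@lebesgue_measure R) V.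
Proof.
move=> /nbhs_ballP[e /= e0 eV] [A [mA A0 VA]].
have mb := measurable_ball x e.
have : (@lebesgue_measure R (ball x e) <= @lebesgue_measure R A)%E.
  by apply: le_measure; rewrite ?inE//; exact: subset_trans VA.
by rewrite A0 (lebesgue_measure_ball _ (ltW e0)) lee_fin leNgt mulrn_wgt0.
Qed.

(* [K] is the intersection over n of the finite unions of balls of radius
   1/(n+1) covering it. *)
Lemma measurable_compact_rV (K : set 'rV[R]_r) : compact K -> measurable K.
Proof.
move=> cK; have clK : closed K by apply: compact_closed => //; exact: norm_hausdorff.
have fincov (n : nat) : exists D : {fset 'rV[R]_r},
    {subset D <= K} /\ K `<=` \bigcup_(x in [set` D]) ball x n.+1%:R^-1.
  have := cK; rewrite compact_cover => /(_ _ K (fun x => (ball x n.+1%:R^-1)°)).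
  case=> [x _|x Kx|D DK KD]; first exact: open_interior.
    by exists x => //; exact: nbhsx_ballx.
  exists D; split=> // x /KD[y Dy /interior_subset ?]; exists y => //.
have [D DP] := choice fincov.
rewrite (_ : K = \bigcap_n \bigcup_(x in [set` D n]) ball x n.+1%:R^-1).
  apply: bigcapT_measurable => n; rewrite bigcup_fset.
  by apply: bigsetU_measurable => x _; exact: measurable_rV_ball.
apply/seteqP; split=> [x Kx n _|x xD]; first exact: (DP n).2.
(* For every [n] some point of [K] is within [1/(n+1)] of [x], so [x] is in the closure of [K]. *)
apply: clK => V /nbhs_ballP[e /= e0 eV].
have [n ne] : exists n, n.+1%:R^-1 < e.
  have := near_infty_natSinv_lt (PosNum e0) => -[n _ /(_ n (leqnn n))]; by exists n.
have [y Dy yx] := xD n I.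
exists y; split; first by have := (DP n).1 y Dy; rewrite inE.
by apply: eV; apply: ball_sym; apply: le_ball yx; exact: ltW.
Qed.

End lebesgueRn_balls.

(** * Zeros of analytic functions *)

Section power_series_zeros.
Context (R : realType).

(** The first nonzero term dominates: for small nonzero [s] the rest of the series is at most half
    of it, so [f s] cannot vanish. *)
Lemma power_series_isolated_zero (b : nat -> R) (f : R -> R) (rho : R) n0 :
  0 < rho -> b n0 != 0 ->
  (forall s : R, `|s| < rho ->
    (fun N => \sum_(0 <= n < N) b n * s ^+ n) @ \oo --> f s) ->
  exists2 e, 0 < e & forall s : R, s != 0 -> `|s| < e -> f s != 0.
Proof.
move=> rho0 bn0 bf.
have [m bm mmin] : exists2 m, b m != 0 & forall n, (n < m)%N -> b n = 0.
  have ex : exists n, b n != 0 by exists n0.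
  exists (ex_minn ex); first by case: ex_minnP.
  case: ex_minnP => k _ kmin n nk; apply/eqP; apply: contraTT nk => /kmin.
  by rewrite leqNgt.
pose s0 := rho / 2; have s00 : 0 < s0 by rewrite divr_gt0.
(* The terms of a series convergent at [s0] are bounded, so for smaller [s] the tail is dominated by
   a geometric series. *)
have [M M0 bM] : exists2 M : R, 0 < M & forall n, `|b n * s0 ^+ n| <= M.
  have /bf /cvgP cs : `|s0| < rho.
    by rewrite gtr0_norm// /s0 ltr_pdivrMr// ltr_pMr// ltr1n.
  have /cvgP/cvg_seq_bounded [M [_ MP]] :=
    @cvg_series_cvg_0 _ _ (fun n => b n * s0 ^+ n) cs.
  exists (`|M| + 1); first by rewrite ltr_pwDr.
  by move=> n; apply: MP => //; rewrite (le_lt_trans (ler_norm _))// ltrDl.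
(* The bound [M] makes the tail beyond the leading term at most 2 M q^(m+1) for
   |s| = q s0 with q <= 1/2; [q1] is the threshold below which this is at most
   half of the leading term |b m| q^m s0^m. *)
pose q1 := `|b m| * s0 ^+ m / (4 * M).
have q10 : 0 < q1.
  by rewrite /q1 divr_gt0 ?mulr_gt0 ?exprn_gt0 ?normr_gt0//.
exists (s0 * Num.min q1 2^-1); first by rewrite mulr_gt0// lt_min q10 invr_gt0 ltr0n.
move=> s sn0 ss.
pose q := `|s| / s0.
have sE : `|s| = q * s0 by rewrite /q divfK// gt_eqF.
have q0 : 0 < q by rewrite divr_gt0// normr_gt0.
have /andP[qq1 qh] : (q < q1) && (q < 2^-1).
  by rewrite -lt_min /q ltr_pdivrMr// mulrC.
have q1n0 : 0 < 1 - q by rewrite subr_gt0 (lt_trans qh)// invf_lt1// ltr1n.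
have srho : `|s| < rho.
  apply: lt_trans (_ : s0 < rho).
    by rewrite sE gtr_pMl// (lt_trans qh)// invf_lt1// ltr1n.
  by rewrite /s0 ltr_pdivrMr// ltr_pMr// ltr1n.
pose L := `|b m| * `|s| ^+ m.
have L0 : 0 < L by rewrite mulr_gt0 ?normr_gt0// exprn_gt0// normr_gt0.
have tail k : `|\sum_(m.+1 <= n < m.+1 + k) b n * s ^+ n| <= L / 2.
  apply: (@le_trans _ _ (M * q ^+ m.+1 / (1 - q))).
    rewrite ler_pdivlMr//.
    apply: (@le_trans _ _ (M * (q ^+ m.+1 - q ^+ (m.+1 + k)))); last first.
      by rewrite ler_pM2l// gerBl exprn_ge0// ltW.
    (* The bound telescopes: one more term raises it by [M * q ^+ (m.+1 + k) * (1 - q)]. *)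
    elim: k => [|k IHk]; first by rewrite addn0 big_geq// normr0 mul0r subrr mulr0.
    rewrite addnS big_nat_recr/= ?leq_addr//.
    have bs : `|b (m.+1 + k)%N * s ^+ (m.+1 + k)| <= M * q ^+ (m.+1 + k).
      rewrite normrM normrX sE exprMn mulrCA [leLHS]mulrC ler_pM2r ?exprn_gt0//.
      by have := bM (m.+1 + k)%N; rewrite normrM normrX (gtr0_norm s00).
    apply: (@le_trans _ _ ((`|\sum_(m.+1 <= n < m.+1 + k) b n * s ^+ n| +
        `|b (m.+1 + k)%N * s ^+ (m.+1 + k)|) * (1 - q))).
      by rewrite ler_pM2r// ler_normD.
    rewrite mulrDl (le_trans (lerD IHk (_ : _ <= (M * q ^+ (m.+1 + k)) * (1 - q))))//.
      by rewrite ler_pM2r.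
    by rewrite -mulrA -mulrDr ler_pM2l// mulrBr mulr1 -exprSr addrA subrK.
  rewrite ler_pdivrMr//.
  have -> : L = `|b m| * (q ^+ m * s0 ^+ m) by rewrite /L sE exprMn.
  have H : M * q ^+ m.+1 <= `|b m| * (q ^+ m * s0 ^+ m) / 2 / 2.
    move: qq1; rewrite /q1 ltr_pdivlMr ?mulr_gt0// => /ltW qq1.
    have qm : 0 < q ^+ m by rewrite exprn_gt0.
    rewrite exprS -subr_ge0.
    have -> : `|b m| * (q ^+ m * s0 ^+ m) / 2 / 2 - M * (q * q ^+ m) =
      q ^+ m / 4 * (`|b m| * s0 ^+ m - q * (4 * M)) by field.
    by rewrite mulr_ge0// ?subr_ge0// divr_ge0// ltW.
  apply: (le_trans H); rewrite ler_pM2l//; last first.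
    by rewrite divr_gt0// !mulr_gt0 ?normr_gt0 ?exprn_gt0.
  by move: qh; clear; lra.
suff fsL : L / 2 <= `|f s| by rewrite -normr_gt0 (lt_le_trans _ fsL)// divr_gt0.
have cn : (fun N => `|\sum_(0 <= n < N) b n * s ^+ n|) @ \oo --> `|f s|.
  by apply: cvg_norm; exact: bf.
rewrite -(cvg_lim (@Rhausdorff _) cn).
(* A partial sum with more than [m] terms is the leading term plus a tail, so its modulus is at
   least [L - L / 2]; the bound passes to the limit. *)
apply: limr_ge; first by apply/cvg_ex; exists `|f s|.
exists m.+1 => // N /= mN.
rewrite -(subnKC mN) (big_cat_nat (n := m.+1))/= ?leq_addr// big_nat_recr//=.
rewrite big_nat_cond big1 ?add0r; last first.
  by move=> n /andP[/andP[_ /mmin ->] _]; rewrite mul0r.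
have := tail (N - m.+1)%N.
have := ler_normD (b m * s ^+ m + \sum_(m.+1 <= n < m.+1 + (N - m.+1)) b n * s ^+ n)
  (- \sum_(m.+1 <= n < m.+1 + (N - m.+1)) b n * s ^+ n).
rewrite addrK normrN normrM normrX -/L.
by clear; lra.
Qed.

End power_series_zeros.

(** * Taylor expansions: restriction to axes and measurability *)

Section taylor.
Context (R : realType) (r : nat).
Local Notation multi := {ffun 'I_r -> nat}.
Implicit Types (x : 'rV[R]_r) (i : 'I_r).

(* An exhaustion of the multi-indices, turning unconditional sums into limits of
   sequences. *)
Definition cube N : {fset multi} :=
  [fset k in [seq [ffun j => nat_of_ord (g j)] : multi
             | g : {ffun 'I_r -> 'I_N} <- enum {ffun 'I_r -> 'I_N}]]%fset.

Lemma mem_cube N (k : multi) : (k \in cube N) = [forall j, (k j < N)%N].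
Proof.
rewrite !inE; apply/mapP/forallP => [[g _ ->] j|kN]; first by rewrite ffunE.
exists [ffun j => Ordinal (kN j)]; first by rewrite mem_enum.
by apply/ffunP => j; rewrite !ffunE.
Qed.

(** A finite set of multi-indices lies in [cube N] once [N] exceeds all its entries. *)
Lemma cube_totally : cube @ \oo --> totally.
Proof.
move=> /= P [A _ AP]; exists (\max_(k <- A) \max_j k j).+1 => // N /= AN.
apply: AP; apply/fsubsetP => k kA; rewrite mem_cube; apply/forallP => j.
apply: leq_trans AN; rewrite ltnS.
apply: leq_trans (leq_bigmax_seq (F := fun k : multi => \max_j k j) k kA isT).
exact: leq_bigmax.
Qed.

Definition monomial (v : 'rV[R]_r) (k : multi) : R := \prod_j v ord0 j ^+ k j.

Definition axis i (n : nat) : multi := [ffun j => if j == i then n else 0%N].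

Lemma monomial_axis i (s : R) n : monomial (s *: delta_mx ord0 i) (axis i n) = s ^+ n.
Proof.
rewrite /monomial (bigD1 i)//= big1 ?mulr1; last first.
  by move=> j /negbTE ji; rewrite ffunE ji.
by rewrite !mxE !ffunE !eqxx mulr1.
Qed.

Lemma monomial_off_axis i (s : R) (k : multi) : k != axis i (k i) ->
  monomial (s *: delta_mx ord0 i) k = 0.
Proof.
move=> ki; have [j ji kj] : exists2 j, j != i & k j != 0%N.
  apply/exists_inP; apply: contraNT ki => /exists_inPn kj.
  apply/eqP/ffunP => j; rewrite ffunE; case: eqP => [->//|/eqP ji].
  by have := kj j ji; rewrite negbK => /eqP.
rewrite /monomial (bigD1 j)//= !mxE (negbTE ji) andbF mulr0 expr0n.
by rewrite (negbTE kj) mul0r.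
Qed.

(** On the [i]-th axis only the powers of the [i]-th variable survive, so the multi-index series
    becomes a power series in one variable. *)
Lemma cube_sum_axis i (s : R) (a : multi -> R) N :
  \sum_(k <- cube N) a k * monomial (s *: delta_mx ord0 i) k =
  \sum_(0 <= n < N) a (axis i n) * s ^+ n.
Proof.
pose B := [fset axis i n | n in iota 0 N]%fset.
have BN : (B `<=` cube N)%fset.
  apply/fsubsetP => k /imfsetP[n /=]; rewrite mem_iota => /andP[_ nN] ->.
  rewrite mem_cube; apply/forallP => j; rewrite ffunE; case: ifP => // _.
  exact: leq_ltn_trans nN.
rewrite -(big_fset_incl _ BN)/=; last first.
  move=> k; rewrite mem_cube => /forallP kN kB; rewrite monomial_off_axis ?mulr0//.
  apply: contra kB => /eqP kE; apply/imfsetP; exists (k i) => //=.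
  by rewrite mem_iota /= add0n kN.
rewrite big_imfset/=; last by move=> m n _ _ /ffunP/(_ i); rewrite !ffunE eqxx.
rewrite undup_id ?iota_uniq// /index_iota subn0; apply: eq_bigr => n _.
by rewrite monomial_axis.
Qed.

(* Applied to [Re] and [Im], this turns a complex Taylor expansion into two real
   ones. *)
Definition short_functional (L : R[i] -> R) :=
  [/\ {morph L : z w / z + w}, forall z, (`|L z|)%:C%C <= `|z| &
      forall z (a : R), L (z * a%:C%C) = L z * a].

Lemma short_functional_Re : short_functional (@complex.Re R).
Proof.
split; [by case=> ? ? [? ?]|exact: normc_ge_Re|].
by case=> a b c /=; rewrite mulr0 subr0.
Qed.

Lemma short_functional_Im : short_functional (@complex.Im R).
Proof.
split; [by case=> ? ? [? ?]| |by case=> a b c /=; rewrite mulr0 add0r].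
(* Multiplication by ['i] preserves the modulus and turns the real part into minus the imaginary
   part. *)
move=> z; have := normc_ge_Re (z * 'i%C).
rewrite normrM (_ : `|'i%C| = 1 :> R[i]); last first.
  by rewrite normc_def /= expr0n expr1n add0r sqrtr1.
by rewrite mulr1 ReiNIm normrN.
Qed.

(** A short functional is 1-Lipschitz, so it preserves the limit; real homogeneity moves it past the
    real monomials onto the coefficients. *)
Lemma taylor_cube (L : R[i] -> R) (c : multi -> R[i]) x (l : R[i]) :
  short_functional L ->
  (partial_sum (fun k => c k * (monomial x k)%:C%C) : _ -> R[i]^o) @ totally
    --> (l : R[i]^o) ->
  (fun N => \sum_(k <- cube N) L (c k) * monomial x k) @ \oo --> L l.
Proof.
move=> [LD L1 LZ] /(cvg_comp _ _ cube_totally) cl.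
apply/cvgrPdist_lt => e e0.
have e0C : 0 < (e%:C%C : R[i]) by rewrite ltcR.
move/cvgrPdist_lt : cl => /(_ _ e0C).
apply: filterS => N /= lN; rewrite -ltcR; apply: le_lt_trans lN.
rewrite (_ : _ - _ = L (l - partial_sum (fun k => c k * (monomial x k)%:C%C) (cube N)))//.
have L0 : L 0 = 0 by rewrite -[X in L X](mul0r 0) (LZ 0 0) mulr0.
have LN z : L (- z) = - L z.
  by rewrite -mulrN1 -[X in z * X](rmorphN1 (real_complex R)) LZ mulrN1.
rewrite LD LN /partial_sum big_seq_fsetE/= (big_morph L LD L0); congr (_ - _).
by apply: eq_bigr => k _; rewrite LZ.
Qed.

Definition taylor_re_im (h : 'rV[R]_r -> R[i]) x0 (c : multi -> R[i]) x :=
  forall L, short_functional L ->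
    (fun N => \sum_(k <- cube N) L (c k) * monomial (x - x0) k) @ \oo --> L (h x).

Lemma taylor_at_re_im (h : 'rV[R]_r -> R[i]) x0 : taylor_at h x0 ->
  exists c, \forall x \near x0, taylor_re_im h x0 c x.
Proof.
move=> [c hc]; exists c; apply: filterS hc => x hx L HL.
apply: taylor_cube => //.
rewrite (_ : (fun k => _) = (fun k : multi =>
    c k * (\prod_j (x ord0 j - x0 ord0 j) ^+ k j)%:C%C))//.
apply/funext => k; congr (_ * _%:C%C).
by apply: eq_bigr => j _; rewrite !mxE.
Qed.

(** If a short functional is nonzero on some coefficient along the axis, its composite with [h] has
    at most an isolated zero at [s = 0]. Otherwise the real and imaginary parts of [h] both vanish
    along the axis near [x0]. *)
Lemma taylor_at_axis (h : 'rV[R]_r -> R[i]) x0 i : taylor_at h x0 ->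
  exists2 e, 0 < e &
    (forall s : R, `|s| < e -> h (x0 + s *: delta_mx ord0 i) = 0) \/
    (forall s : R, s != 0 -> `|s| < e -> h (x0 + s *: delta_mx ord0 i) != 0).
Proof.
move=> /taylor_at_re_im[c /nbhs_ballP[e /= e0 hc]].
have axisP (s : R) : `|s| < e -> forall L, short_functional L ->
    (fun N => \sum_(0 <= n < N) L (c (axis i n)) * s ^+ n) @ \oo -->
    L (h (x0 + s *: delta_mx ord0 i)).
  move=> se L HL; have /hc/(_ L HL) : ball x0 e (x0 + s *: delta_mx ord0 i).
    split=> // j' j; rewrite ord1 /ball/= !mxE opprD addNKr normrN normrM.
    rewrite (le_lt_trans _ se)// ler_piMr//.
    by case: (_ && _); rewrite ?normr1 ?normr0.
  by rewrite addrC addKr; under eq_fun do rewrite cube_sum_axis.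
have [[L [HL [n cn]]]|nL] := pselect (exists L, short_functional L /\
    exists n, L (c (axis i n)) != 0).
  have [d d0 dh] := power_series_isolated_zero e0 cn (fun s se => axisP s se L HL).
  exists d => //; right => s s0 /(dh s s0).
  apply: contra => /eqP ->; have [_ _ LZ] := HL.
  by rewrite -[X in L X](mul0r 0) (LZ 0 0) mulr0.
exists e => //; left => s se.
have L0 L : short_functional L -> L (h (x0 + s *: delta_mx ord0 i)) = 0.
  move=> HL; rewrite -(cvg_lim (@Rhausdorff _) (axisP s se L HL)).
  rewrite (_ : (fun _ => _) = cst 0) ?lim_cst//; apply/funext => N.
  rewrite big1// => n _; apply/eqP; rewrite mulf_eq0; apply/orP; left.
  by apply: contrapT => /negP cn; apply: nL; exists L; split => //; exists n.
apply/eqP; rewrite eq_complex.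
by rewrite (L0 _ short_functional_Re) (L0 _ short_functional_Im) !eqxx.
Qed.

Lemma measurable_coord (j : 'I_r) :
  measurable_fun setT (fun x => x ord0 j : R).
Proof.
rewrite (_ : (fun _ => _) = (fun t => tnth t j) \o @tuple_of_rV R r).
  apply: measurableT_comp; [exact: measurable_tnth|exact: measurable_tuple_of_rV].
by apply/funext => x /=; rewrite tnth_mktuple.
Qed.

(** Near [x0] the real and imaginary parts of [h] are pointwise limits of polynomials, hence
    measurable. *)
Lemma taylor_at_measurable_zeros (h : 'rV[R]_r -> R[i]) x0 : taylor_at h x0 ->
  exists2 e, 0 < e & forall D, measurable D -> D `<=` ball x0 e ->
    measurable (D `&` [set x | h x = 0]).
Proof.
move=> /taylor_at_re_im[c /nbhs_ballP[e /= e0 hc]]; exists e => // D mD De.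
have mL L : short_functional L -> measurable_fun D (fun x => L (h x)).
  move=> HL; pose S N x := \sum_(k <- cube N) L (c k) * monomial (x - x0) k.
  apply: (@measurable_fun_cvg _ _ _ D S) => [N|x /De/hc]; last exact.
  apply: measurable_sum => k; apply: measurable_funM => //.
  apply: measurable_prod => j _; apply: measurable_funX.
  apply: (@eq_measurable_fun _ _ _ _ _ (fun x : 'rV[R]_r => x ord0 j - x0 ord0 j)).
    by move=> x _; rewrite !mxE.
  apply: measurable_funB => //.
  by apply: measurable_funTS; exact: measurable_coord.
have mL0 L (HL : short_functional L) := mL L HL mD _ (measurable_set1 (0 : R)).
rewrite (_ : _ `&` _ = (D `&` (fun x => complex.Re (h x)) @^-1` [set 0]) `&`
    (D `&` (fun x => complex.Im (h x)) @^-1` [set 0])).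
  by apply: measurableI; apply: mL0;
    [exact: short_functional_Re|exact: short_functional_Im].
apply/seteqP; split=> x /=; first by move=> [Dx ->].
move=> [[Dx Re0] [_ Im0]]; split => //.
by apply/eqP; rewrite eq_complex Re0 Im0 eqxx.
Qed.

End taylor.

(** * The zero set of an analytic function: lines, boxes, connected domains *)

Section analytic_zeros.
Context (R : realType) (r : nat).
Local Notation leb := (@lebesgueRn R r).
Implicit Types (x : 'rV[R]_r) (h : 'rV[R]_r -> R[i]) (U K : set 'rV[R]_r).

Lemma rV_of_tuple_tset (t : r.-tuple (measurableTypeR R)) (i : 'I_r) (y z : R) :
  rV_of_tuple (tset t i z) = rV_of_tuple (tset t i y) + (z - y) *: delta_mx ord0 i.
Proof.
apply/rowP => j; rewrite !mxE !tnth_mktuple eqxx /=.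
by case: eqP => _; rewrite ?mulr1 ?mulr0 ?addr0// addrC subrK.
Qed.

(** The gap [d < rho] leaves room for a compact segment between the two intervals: connectedness is
    used on the larger one, compactness on the segment. *)
Lemma line_zero_dichotomy h (t : r.-tuple (measurableTypeR R)) (i : 'I_r)
    (a rho d : R) : d < rho ->
  (forall y, ball a rho y -> taylor_at h (rV_of_tuple (tset t i y))) ->
  (forall y, ball a d y -> h (rV_of_tuple (tset t i y)) = 0) \/
  negligible (@lebesgue_measure R)
    [set y | ball a d y /\ h (rV_of_tuple (tset t i y)) = 0].
Proof.
move=> drho ht; pose Z := [set y : R | h (rV_of_tuple (tset t i y)) = 0].
have /= H := @connected_zero_dichotomy R (negligible (@lebesgue_measure R)) _ _ _
  (ball a rho) `[a - d, a + d] Z.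
have sub : ball a d `<=` ball a rho by apply: le_ball; exact: ltW.
have sub' : `[a - d, a + d] `<=` ball a rho.
  move=> y; rewrite /ball/= in_itv/= ltr_distlC => /andP[ady yad].
  by move: drho ady yad; clear; lra.
case: H => //.
- exact: negligible_set0.
- move=> A B AB; exact: negligibleS.
- move=> A B; exact: negligibleU.
- by rewrite ball_itv; apply/connected_intervalP; exact: interval_is_interval.
- exact: segment_compact.
- move=> x V; exact: lebesgue_nbhs_not_negligible.
- move=> y /ht /(taylor_at_axis i)[e e0 [he|he]]; [left|right].
    apply/nbhs_ballP; exists e => // z yz.
    rewrite /Z/= (rV_of_tuple_tset _ _ y) he// distrC; exact: yz.
  (* An isolated zero: this neighbourhood meets [Z] at most in [y], and a singleton is null. *)
  exists (ball y e); first exact: nbhsx_ballx.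
  exists [set y]; split => //; first exact: lebesgue_measure_set1.
  move=> z [yz]; rewrite /Z/= (rV_of_tuple_tset _ _ y) => /eqP hz.
  apply: contrapT => zy; move: hz; apply/negP; apply: he.
    by rewrite subr_eq0; exact/eqP.
  rewrite distrC; exact: yz.
- by move=> UZ; left => y /sub /UZ.
- move=> NZ; right; apply: negligibleS NZ => y [ady hy]; split => //=.
  move: ady; rewrite /ball/= in_itv/= ltr_distlC => /andP[].
  by clear; lra.
Qed.

(** In a small box around [x0], each section of the zero set parallel to an axis is full or null by
    [line_zero_dichotomy]; the Fubini dichotomy then applies to the box. *)
Lemma analytic_local_zero_dichotomy h U x0 : open U ->
  (forall x, U x -> taylor_at h x) -> U x0 ->
  nbhs x0 [set x | h x = 0] \/
  exists2 V, nbhs x0 V & leb.-negligible (V `&` [set x | h x = 0]).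
Proof.
move=> oU hU Ux0.
have [rho [rho0 rhoU mZ]] : exists rho, [/\ 0 < rho, ball x0 rho `<=` U &
    forall D, measurable D -> D `<=` ball x0 rho ->
    measurable (D `&` [set x | h x = 0])].
  have /nbhs_ballP[e1 /= e10 e1U] : nbhs x0 U by exact: open_nbhs_nbhs.
  have [e2 e20 e2Z] := taylor_at_measurable_zeros (hU _ Ux0).
  exists (Num.min e1 e2); split; first by rewrite lt_min e10.
    by apply: subset_trans e1U; apply: le_ball; rewrite ge_min lexx.
  move=> D mD De; apply: e2Z => //; apply: (subset_trans De); apply: le_ball.
  by rewrite ge_min lexx orbT.
pose d := rho / 2; have d0 : 0 < d by rewrite divr_gt0.
have drho : d < rho by rewrite /d ltr_pdivrMr// ltr_pMr// ltr1n.
pose Q k : set (measurableTypeR R) := ball (nth 0 (tuple_of_rV x0) k) d.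
pose Z := @rV_of_tuple R r @^-1` (ball x0 d `&` [set x | h x = 0]).
have mB : measurable (ball x0 d `&` [set x | h x = 0]).
  by apply: mZ; [exact: measurable_rV_ball|apply: le_ball; exact: ltW].
have [||||QZ|Z0] := @power_measure_dichotomy _ (measurableTypeR R) R
  (@lebesgue_measure R) Q r Z.
- move=> k; exact: measurable_ball.
- by rewrite -[X in measurable X]setTI; exact: measurable_rV_of_tuple.
- by rewrite /Q -preimage_rV_ball// => t [].
- move=> t i tQ.
  (* Taken with [e = rho], this keeps the line inside [U]; with [e = d], it brings the zeros back
     into [Z]. *)
  have tball (e : R) y : d <= e -> ball (x0 ord0 i) e y ->
      ball x0 e (rV_of_tuple (tset t i y)).
    move=> de y_e; split=> [|k j]; first exact: lt_le_trans de.
    rewrite ord1 mxE tnth_mktuple; case: eqP => [->//|_].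
    apply: le_ball de _ _; have := tQ j.
    by rewrite /Q -tnth_nth tnth_mktuple.
  have Qi : Q i = ball (x0 ord0 i) d by rewrite /Q -tnth_nth tnth_mktuple.
  have [y /tball yb||] := @line_zero_dichotomy h t i (x0 ord0 i) rho d drho.
  + by apply/hU/rhoU/yb; exact: ltW.
  + move=> zero; left => y; rewrite Qi => yd; split; last exact: zero.
    exact: tball.
  + move=> neg; right; apply: negligibleS neg => y [[_ yb] hy]; split => //.
    by have := yb ord0 i; rewrite mxE tnth_mktuple eqxx.
- left; apply/nbhs_ballP; exists d => // x xd.
  have : Z (tuple_of_rV x).
    by apply: QZ; rewrite /Q -preimage_rV_ball// /preimage/= tuple_of_rVK.
  by rewrite /Z/preimage/= tuple_of_rVK => -[].
- right; exists (ball x0 d); first exact: nbhsx_ballx.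
  by exists (ball x0 d `&` [set x | h x = 0]); split.
Qed.

Lemma analytic_zero_dichotomy h U K : open U -> connected U ->
  (forall x, U x -> taylor_at h x) -> compact K -> K `<=` U ->
  (forall x, U x -> h x = 0) \/ leb.-negligible (K `&` [set x | h x = 0]).
Proof.
move=> oU cU hU cK KU.
apply: (@connected_zero_dichotomy _ (negligible leb)) => //.
- exact: negligible_set0.
- move=> A B AB; exact: negligibleS.
- move=> A B; exact: negligibleU.
- move=> x V; exact: lebesgueRn_nbhs_not_negligible.
- move=> x; exact: analytic_local_zero_dichotomy.
Qed.

End analytic_zeros.

(** * Evaluation matrices *)

Section lspan.
Context (K : fieldType) (M : lmodType K).
Implicit Types (S : set M) (u v : M).

Lemma lspan0 S : lspan S 0.
Proof.
exists 0%N, (fun=> 0), (fun=> 0).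
by split=> [[]//|]; rewrite big_ord0.
Qed.

Lemma lspan_linear S (a : K) u v : lspan S u -> lspan S v -> lspan S (a *: u + v).
Proof.
move=> [m [c [s [sS ->]]]] [n [e [t [tS ->]]]].
exists (m + n)%N, (fun i => match fintype.split i with inl j => a * c j | inr j => e j end),
  (fun i => match fintype.split i with inl j => s j | inr j => t j end); split.
  by move=> i; case: (fintype.split i).
rewrite big_split_ord scaler_sumr; congr (_ + _); apply: eq_bigr => i _.
  by rewrite (unsplitK (inl i)) scalerA.
by rewrite (unsplitK (inr i)).
Qed.

Lemma lspan_range d (b : 'I_d -> M) u :
  lspan (range b) u <-> exists c : 'I_d -> K, u = \sum_i c i *: b i.
Proof.
split=> [[m [c [s [sb ->]]]]|[c ->]]; last first.
  by exists d, c, b; split => // i; exists i.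
have /choice[j jP] : forall i, exists k, b k = s i.
  by move=> i; have [k _ bk] := sb i; exists k.
(* The coefficients of all terms assigned to the same [b k] are added up. *)
exists (fun k => \sum_(i | j i == k) c i).
rewrite (partition_big j xpredT)//=; apply: eq_bigr => k _.
by rewrite scaler_suml; apply: eq_bigr => i /eqP <-; rewrite jP.
Qed.

End lspan.

(** The indices that permute the image also permute the source. This serves to list the points of
    [W] with their vertices in a prescribed order. *)
Lemma perm_map_lift (T S : eqType) (f : T -> S) (s : seq S) (t : seq T) :
  perm_eq s (map f t) -> exists2 w, perm_eq w t & map f w = s.
Proof.
case: t => [|p0 t] st.
  by exists [::] => //; apply/esym/nilP; rewrite /nilp (perm_size st).
have /(perm_iotaP (f p0))[Is] := st; rewrite size_map => IsP ->.
exists (map (nth p0 (p0 :: t)) Is).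
  by rewrite -[X in perm_eq _ X](mkseq_nth p0 (p0 :: t)); exact: perm_map.
rewrite -map_comp; apply/eq_in_map => i.
rewrite (perm_mem IsP) mem_iota => it.
exact: esym (nth_map p0 (f p0) f it).
Qed.

(** * Measurability of complex functions and determinants *)

Section complex_measurable.
Context d (T : measurableType d) (R : realType).
Implicit Types f g : T -> R[i].

Definition cmeasurable f :=
  measurable_fun setT (fun x => complex.Re (f x)) /\
  measurable_fun setT (fun x => complex.Im (f x)).

Lemma cmeasurable_cst (a : R[i]) : cmeasurable (fun=> a).
Proof. by split; exact: measurable_cst. Qed.

Lemma cmeasurableD f g : cmeasurable f -> cmeasurable g ->
  cmeasurable (fun x => f x + g x).
Proof.
move=> [fR fI] [gR gI]; split.
  rewrite (_ : (fun _ => _) = fun x => complex.Re (f x) + complex.Re (g x)).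
    exact: measurable_funD.
  by apply/funext => x; case: (f x) (g x) => [? ?] [? ?].
rewrite (_ : (fun _ => _) = fun x => complex.Im (f x) + complex.Im (g x)).
  exact: measurable_funD.
by apply/funext => x; case: (f x) (g x) => [? ?] [? ?].
Qed.

Lemma cmeasurableM f g : cmeasurable f -> cmeasurable g ->
  cmeasurable (fun x => f x * g x).
Proof.
move=> [fR fI] [gR gI]; split.
  rewrite (_ : (fun _ => _) = fun x => complex.Re (f x) * complex.Re (g x) -
      complex.Im (f x) * complex.Im (g x)).
    by apply: measurable_funB; exact: measurable_funM.
  by apply/funext => x; case: (f x) (g x) => [? ?] [? ?].
rewrite (_ : (fun _ => _) = fun x => complex.Re (f x) * complex.Im (g x) +
    complex.Im (f x) * complex.Re (g x)).
  by apply: measurable_funD; exact: measurable_funM.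
by apply/funext => x; case: (f x) (g x) => [? ?] [? ?].
Qed.

Lemma cmeasurable_sum (I : Type) (s : seq I) (P : pred I) (F : I -> T -> R[i]) :
  (forall i, cmeasurable (F i)) -> cmeasurable (fun x => \sum_(i <- s | P i) F i x).
Proof.
move=> mF; elim: s => [|i s IHs].
  rewrite (_ : (fun _ => _) = fun=> 0); first exact: cmeasurable_cst.
  by apply/funext => x; rewrite big_nil.
case Pi : (P i); last first.
  by rewrite (_ : (fun _ => _) = (fun x => \sum_(i <- s | P i) F i x))//;
    apply/funext => x; rewrite big_cons Pi.
rewrite (_ : (fun _ => _) = (fun x => F i x + \sum_(i <- s | P i) F i x)).
  exact: cmeasurableD.
by apply/funext => x; rewrite big_cons Pi.
Qed.

Lemma cmeasurable_prod (I : Type) (s : seq I) (P : pred I) (F : I -> T -> R[i]) :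
  (forall i, cmeasurable (F i)) -> cmeasurable (fun x => \prod_(i <- s | P i) F i x).
Proof.
move=> mF; elim: s => [|i s IHs].
  rewrite (_ : (fun _ => _) = fun=> 1); first exact: cmeasurable_cst.
  by apply/funext => x; rewrite big_nil.
case Pi : (P i); last first.
  by rewrite (_ : (fun _ => _) = (fun x => \prod_(i <- s | P i) F i x))//;
    apply/funext => x; rewrite big_cons Pi.
rewrite (_ : (fun _ => _) = (fun x => F i x * \prod_(i <- s | P i) F i x)).
  exact: cmeasurableM.
by apply/funext => x; rewrite big_cons Pi.
Qed.

Lemma cmeasurable_det n (A : T -> 'M[R[i]]_n) :
  (forall i j, cmeasurable (fun x => A x i j)) -> cmeasurable (fun x => \det (A x)).
Proof.
move=> mA; apply: cmeasurable_sum => s; apply: cmeasurableM.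
  exact: cmeasurable_cst.
by apply: cmeasurable_prod => i; exact: mA.
Qed.

Lemma cmeasurable_zeros f : cmeasurable f -> measurable [set x | f x = 0].
Proof.
move=> [fR fI].
rewrite (_ : mkset _ = ((fun x => complex.Re (f x)) @^-1` [set 0]) `&`
    ((fun x => complex.Im (f x)) @^-1` [set 0])).
  apply: measurableI; rewrite -[X in measurable X]setTI;
    [exact: fR|exact: fI].
apply/seteqP; split=> x /=; first by move=> ->.
by move=> [Re0 Im0]; apply/eqP; rewrite eq_complex Re0 Im0 eqxx.
Qed.

End complex_measurable.

Lemma cmeasurable_comp d1 d2 (T1 : measurableType d1) (T2 : measurableType d2)
    (R : realType) (f : T2 -> R[i]) (g : T1 -> T2) :
  cmeasurable f -> measurable_fun setT g -> cmeasurable (f \o g).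
Proof.
by move=> [fR fI] mg; split; [apply: (measurableT_comp fR)|apply: (measurableT_comp fI)].
Qed.

(** * The determinant of evaluations as a function of the sample points *)

Section evaluation.
Context (R : realType) (r : nat) (Omega : set 'rV[R]_r).
Hypothesis Omega_compact : compact Omega.
Variables (H : set (L2 Omega)) (ev : L2 Omega -> 'rV[R]_r -> R[i]).
Hypothesis H_ev : analytic_evaluation H ev.
Hypotheses (H0 : H 0) (HD : forall a u v, H u -> H v -> H (a *: u + v)).

Lemma H_sum (I : Type) (s : seq I) (a : I -> R[i]) (u : I -> L2 Omega) :
  (forall i, H (u i)) -> H (\sum_(i <- s) a i *: u i).
Proof.
move=> Hu; elim: s => [|i s IHs]; first by rewrite big_nil.
by rewrite big_cons; exact: HD.
Qed.

Lemma ev0 x : Omega x -> ev 0 x = 0.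
Proof.
move=> Ox; have := H_ev.2 1 _ _ H0 H0 x (mem_set Ox).
by rewrite scaler0 addr0 mul1r => /eqP; rewrite -subr_eq subrr => /eqP <-.
Qed.

Lemma ev_sum (I : Type) (s : seq I) (a : I -> R[i]) (u : I -> L2 Omega) x :
  (forall i, H (u i)) -> Omega x ->
  ev (\sum_(i <- s) a i *: u i) x = \sum_(i <- s) a i * ev (u i) x.
Proof.
move=> Hu Ox; elim: s => [|i s IHs]; first by rewrite !big_nil ev0.
rewrite !big_cons (H_ev.2 _ _ _ (Hu i) (H_sum _ _ Hu) x (mem_set Ox)).
by rewrite IHs.
Qed.

(** The dichotomy is applied to the analytic extension [h] on its connected domain; [h] agrees with
    [ev u] on the compact set [Omega]. *)
Lemma ev_zero_dichotomy u : H u ->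
  (forall x, Omega x -> ev u x = 0) \/
  (@lebesgueRn R r).-negligible [set x | Omega x /\ ev u x = 0].
Proof.
move=> /(H_ev.1)[[U [h [oU cU OU hE hU]]] _].
have [h0|h0] := analytic_zero_dichotomy oU cU hU Omega_compact OU.
  by left => x Ox; rewrite -hE ?inE//; exact/h0/OU.
right; apply: negligibleS h0 => x [Ox evx]; split => //=.
by rewrite hE ?inE.
Qed.

(* Measurability comes from membership in L^2, not from analyticity. *)
Lemma cmeasurable_ev u : H u ->
  cmeasurable (fun x => ev u x * (\1_Omega x)%:C%C).
Proof.
move=> /(H_ev.1)[_ [f fE _]].
have fO x : ev u x * (\1_Omega x)%:C%C = f x * (\1_Omega x)%:C%C.
  have [xO|xO] := boolP (x \in Omega); first by rewrite fE.
  by rewrite indicE (negbTE xO) !mulr0.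
have /andP[fR fI] := L2repP f.
split.
  rewrite (_ : (fun _ => _) = fun x => complex.Re (f x) * \1_Omega x).
    by have := sub_Lfun_mfun fR; rewrite inE.
  apply/funext => x; rewrite fO.
  by case: (f x) => a b /=; rewrite mulr0 subr0.
rewrite (_ : (fun _ => _) = fun x => complex.Im (f x) * \1_Omega x).
  by have := sub_Lfun_mfun fI; rewrite inE.
apply/funext => x; rewrite fO.
by case: (f x) => a b /=; rewrite mulr0 add0r.
Qed.

Section matrix.
Context (V : finType) (m : nat) (vs : m.-tuple V).
Variable b : 'I_m -> {ffun V -> L2 Omega}.
Hypothesis Hb : forall i v, H (b i v).
Local Notation leb := (lebesgueRn R r).
Implicit Types x : m.-tuple 'rV[R]_r.

(** Rows stand for basis signals and columns for points, so a vector in the left kernel is the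
    coefficient vector of a signal vanishing at all the points. *)
Definition eval_mx x : 'M[R[i]]_m :=
  \matrix_(i, j) ev (b i (tnth vs j)) (tnth x j).

(** Expansion along column [i]: the cofactors do not involve the [i]-th point, so they are constant
    coefficients of an element of [H]. *)
Lemma det_eval_tset x (i : 'I_m) : exists2 u, H u &
  forall y, Omega y -> \det (eval_mx (tset x i y)) = ev u y.
Proof.
exists (\sum_k cofactor (eval_mx x) k i *: b k (tnth vs i)); first exact: H_sum.
move=> y Oy; rewrite (expand_det_col _ i) ev_sum//; apply: eq_bigr => k _.
rewrite mxE tnth_mktuple eqxx mulrC; congr (_ * _).
rewrite /cofactor; congr (_ * \det _); apply/matrixP => p q.
by rewrite !mxE tnth_mktuple [_ == i]eq_sym (negbTE (neq_lift _ _)).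
Qed.

Lemma measurable_det_zeros :
  measurable (tbox (fun=> Omega) m `&` [set x | \det (eval_mx x) = 0]).
Proof.
(* Only the product of [ev] with the indicator of [Omega] is known to be measurable; on the box [A]
   and [eval_mx] coincide. *)
pose A x : 'M[R[i]]_m := \matrix_(i, j)
  (ev (b i (tnth vs j)) (tnth x j) * (\1_Omega (tnth x j))%:C%C).
rewrite (_ : _ `&` _ = tbox (fun=> Omega) m `&` [set x | \det (A x) = 0]).
  apply: measurableI.
    by apply: measurable_tbox => _; exact: measurable_compact_rV.
  apply: cmeasurable_zeros; apply: cmeasurable_det => i j.
  rewrite (_ : (fun _ => _) =
    (fun y => ev (b i (tnth vs j)) y * (\1_Omega y)%:C%C) \o (fun x => tnth x j)).
    by apply: cmeasurable_comp; [exact: cmeasurable_ev|exact: measurable_tnth].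
  by apply/funext => x; rewrite mxE.
have AE x : tbox (fun=> Omega) m x -> A x = eval_mx x.
  move=> xO; apply/matrixP => i j; rewrite !mxE indicE (mem_set (xO j)).
  exact: mulr1.
apply/seteqP; split=> x [xO /= dx]; split => //=; first by rewrite AE.
by rewrite -AE.
Qed.

Lemma det_eval_dichotomy :
  (forall x, tbox (fun=> Omega) m x -> \det (eval_mx x) = 0) \/
  power_measure leb m
    (tbox (fun=> Omega) m `&` [set x | \det (eval_mx x) = 0]) = 0%E.
Proof.
have [||||QZ|] := @power_measure_dichotomy _ _ _ leb (fun=> Omega) m
    (tbox (fun=> Omega) m `&` [set x | \det (eval_mx x) = 0]).
- by move=> _; exact: measurable_compact_rV.
- exact: measurable_det_zeros.
- by move=> x [].
- move=> x i xO; have [u Hu uE] := det_eval_tset x i.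
  have Ox y : Omega y -> tbox (fun=> Omega) m (tset x i y).
    by move=> Oy j; rewrite tnth_mktuple; case: ifP => // _; exact: xO.
  have [u0|u0] := ev_zero_dichotomy Hu; [left|right].
    by move=> y Oy; split; [exact: Ox|rewrite /= uE// u0].
  apply: negligibleS u0 => y [yO /= dy].
  have Oy : Omega y by have := yO i; rewrite tnth_mktuple eqxx.
  by split => //; rewrite -uE.
- by left => x /QZ[].
- by right.
Qed.

End matrix.
End evaluation.

Lemma tensor_val (R : realType) (G : wgraph R) (r : nat) (Omega : set 'rV[R]_r)
    (V' : {vspace {ffun G -> R[i]^o}}) (S : set (L2 Omega)) f v :
  tensor V' (lspan S) f -> lspan S (f v).
Proof.
move=> [n [c [s [sP ->]]]]; rewrite sum_ffunE.
elim/big_ind : _ => [|x y Sx Sy|i _]; first exact: lspan0.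
  by rewrite -[x]scale1r; exact: lspan_linear.
have [phi [h [_ Sh ->]]] := sP i; rewrite !ffunE scalerA -[X in lspan S X]addr0.
by apply: lspan_linear => //; exact: lspan0.
Qed.

(** Since [vs] and the vertices of [W] agree as multisets, the points of [W] can be listed with [vs]
    as vertices. They and the random points are then arguments of the same determinant. *)
Lemma vertices_of_npoints (R : realType) (G : wgraph R) (r m : nat)
    (W : {fset G * 'rV[R]_r}) (vs : m.-tuple G) :
  (forall v, count_mem v vs = npoints v W) ->
  exists w : m.-tuple (G * 'rV[R]_r),
    perm_eq w (enum_fset W) /\ vs = [tuple of map fst w].
Proof.
move=> vsW.
have /perm_map_lift[w wW wvs] : perm_eq vs (map fst (enum_fset W)).
  apply/allP => v _ /=; rewrite vsW count_map /npoints.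
  by rewrite card_fset_sum1 big_fset/= sum1_count.
have sw : size w == m by rewrite -(size_map fst) wvs size_tuple.
by exists (Tuple sw); split => //; exact: val_inj.
Qed.

(** * Determining sets and nonvanishing determinants *)

Section determination.
Context (R : realType) (G : wgraph R) (r : nat) (Omega : set 'rV[R]_r).
Variables (H : set (L2 Omega)) (ev : L2 Omega -> 'rV[R]_r -> R[i]).
Hypothesis H_ev : analytic_evaluation H ev.
Hypotheses (H0 : H 0) (HD : forall a u v, H u -> H v -> H (a *: u + v)).
Context (m : nat) (b : 'I_m -> {ffun G -> L2 Omega}).
Hypothesis Hb : forall i v, H (b i v).
Hypothesis b_free : forall c : 'I_m -> R[i],
  \sum_i c i *: b i = 0 -> forall i, c i = 0.
Implicit Types (x : m.-tuple 'rV[R]_r) (vs : m.-tuple G).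

Lemma ev_comb (c : 'I_m -> R[i]) v (y : 'rV[R]_r) : Omega y ->
  ev ((\sum_i c i *: b i) v) y = \sum_i c i * ev (b i v) y.
Proof.
move=> Oy; rewrite -(ev_sum H_ev H0 HD _ _ (Hb^~ v) Oy); congr (ev _ _).
by rewrite sum_ffunE; apply: eq_bigr => i _; rewrite ffunE.
Qed.

(** A left kernel vector gives a signal that vanishes on [W]. It agrees there with the zero signal,
    hence is zero, and freeness of [b] kills its coefficients. *)
Lemma determines_det_neq0 (W : {fset G * 'rV[R]_r}) (w : m.-tuple (G * 'rV[R]_r)) :
  determines ev (lspan (range b)) m W -> perm_eq w (enum_fset W) ->
  \det (eval_mx ev [tuple of map fst w] b [tuple of map snd w]) != 0.
Proof.
move=> [WO _ Winj] wW; apply/negP => /det0P[c c0 cM]; move/negP: c0; apply.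
apply/eqP/rowP => i; rewrite mxE.
move: i; apply: b_free; apply: Winj.
- by apply/lspan_range; exists (c ord0).
- exact: lspan0.
move=> p pW; have Op := WO p pW; rewrite ev_comb// ffunE (ev0 H_ev H0)//.
have /tnthP[j ->] : p \in w by rewrite (perm_mem wW).
have /rowP/(_ j) := cM; rewrite !mxE => cMj; rewrite -[RHS]cMj.
by apply: eq_bigr => i _; rewrite mxE !tnth_map.
Qed.

Lemma det_neq0_determines vs x : tbox (fun=> Omega) m x ->
  \det (eval_mx ev vs b x) != 0 ->
  determines ev (lspan (range b)) m (sample vs x).
Proof.
move=> xO dx.
(* Two equal points would give two equal columns and a zero determinant; so the sample has exactly
   [m] points. *)
have inj : injective (fun i => (tnth vs i, tnth x i)).
  move=> i j [vij xij]; apply/eqP/negPn/negP => ij; move/negP: dx; apply.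
  apply/eqP; rewrite -det_tr; apply: (determinant_alternate ij) => k.
  by rewrite !mxE vij xij.
split.
- by move=> p /imfsetP[i _ ->]; exact: xO.
- by rewrite /sample card_imfset//= -cardE card_ord.
move=> f g /lspan_range[c ->] /lspan_range[e ->] fg.
(* If two signals agree on the sample, the difference of their coefficient vectors lies in the left
   kernel. *)
have /eqP ce : \row_i (c i - e i) == 0.
  apply/negPn/negP => ce0; move/negP: dx; apply; apply/det0P.
  exists (\row_i (c i - e i)) => //; apply/rowP => j; rewrite !mxE.
  have := fg (tnth vs j, tnth x j) (in_imfset _ _ (isT : j \in 'I_m)).
  rewrite /= !ev_comb//; try exact: xO.
  move=> /eqP; rewrite -subr_eq0 -sumrB => /eqP fgj; rewrite -[RHS]fgj.
  by apply: eq_bigr => i _; rewrite !mxE mulrBl.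
apply: eq_bigr => i _; congr (_ *: _); apply/eqP; rewrite -subr_eq0.
by have /rowP/(_ i) := ce; rewrite !mxE => ->.
Qed.

End determination.

Theorem theorem1 (R : realType) (G : wgraph R)
    (r : nat) (r_ge1 : (1 <= r)%N)
    (Omega : set 'rV[R]_r) (Omega_compact : compact Omega)
    (Omega_int : Omega° !=set0) (Omega_conn : connected Omega°)
    (V' : {vspace {ffun G -> R[i]^o}})
    (H' : set (L2 Omega)) (H'_span : spanned_by_analytic H')
    (ev : L2 Omega -> 'rV[R]_r -> R[i]) (H'_ev : analytic_evaluation H' ev)
    (d : nat) (dim_d : has_dim (tensor V' H') d)
    (W : {fset G * 'rV[R]_r}) (W_det : determines ev (tensor V' H') d W)
    (m : nat) (vs : m.-tuple G) (vs_count : forall v, count_mem v vs = npoints v W)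
    (mu : probability (m.-tuple 'rV[R]_r) R)
    (mu_Omega : mu [set x | forall i, Omega (tnth x i)] = 1%E)
    (mu_ac : mu `<< power_measure (lebesgueRn R r) m) :
  {ae mu, forall x, determines ev (tensor V' H') d (sample vs x)}.
Proof.
have [S _ HS] := H'_span; subst H'.
have H0 : lspan S 0 := lspan0 S.
have HD a u v := @lspan_linear _ _ S a u v.
have [b [b_free VE]] := dim_d.
(* Each [b i] belongs to the tensor space, with Kronecker coefficients, and signals of that space
   take values in the span. *)
have Hb i v : lspan S (b i v).
  apply: (@tensor_val _ _ _ _ V'); rewrite VE; apply/lspan_range.
  exists (fun j => (j == i)%:R); rewrite (bigD1 i)//= eqxx scale1r big1 ?addr0//.
  by move=> j /negbTE ->; rewrite scale0r.
have [w [wW vsE]] := vertices_of_npoints vs_count.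
have md : m = d by have [_ <- _] := W_det; rewrite -(perm_size wW) size_tuple.
rewrite VE in W_det *; subst d vs.
have wO : tbox (fun=> Omega) m [tuple of map snd w].
  move=> i; rewrite tnth_map; have [+ _ _] := W_det; apply.
  by rewrite -[_ \in W]/(_ \in enum_fset W) -(perm_mem wW) mem_tnth.
have dw := determines_det_neq0 H'_ev H0 HD Hb b_free W_det wW.
have mO : measurable (tbox (fun=> Omega) m).
  by apply: measurable_tbox => _; exact: measurable_compact_rV.
(* The points of [W] form a point of the box with nonzero determinant, which excludes identical
   vanishing. *)
have [d0|Z0] := det_eval_dichotomy Omega_compact H'_ev H0 HD [tuple of map fst w] Hb.
  by rewrite d0 ?eqxx in dw.
have mZ := measurable_det_zeros Omega_compact H'_ev [tuple of map fst w] Hb.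
set Z := _ `&` _ in Z0 mZ.
(* Absolute continuity turns the Lebesgue-null set [Z] into a [mu]-null one. *)
have muZ : mu.-negligible Z.
  exists Z; split => //; apply: (mu_ac Z _ Z mZ) => //.
  exact/measure0_null_setP.
have muO : mu.-negligible (~` tbox (fun=> Omega) m).
  exists (~` tbox (fun=> Omega) m); split => //; first exact: measurableC.
  by rewrite probability_setC// mu_Omega subee.
(* A sample that fails to determine the space either leaves the box or has zero determinant. *)
apply: negligibleS (negligibleU muZ muO) => x /= nx.
have [xO|] := pselect (tbox (fun=> Omega) m x); last by right.
left; split => //=; apply: contrapT => dx; apply: nx.
by apply: (det_neq0_determines H'_ev H0 HD Hb) => //; exact/eqP.
Qed.
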